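(* For all $m,n\ge 3$, the state complexity of the product (concatenation) $U_m(a,b,c)\,(U_n(a,b,c))^R$ is $(m-1)2^n+2^{n-1}-(m-1)$.
   Context: The state complexity of a regular language is the number of states of its minimal complete DFA. For $n\ge 3$, $\mathcal{U}_n(a,b,c)$ is the DFA over $\{a,b,c\}$ with states $\{0,\dots,n-1\}$, initial state $0$, final states $\{n-1\}$, where $a$ maps $i\mapsto i+1\pmod n$, $b$ swaps $0$ and $1$ fixing other states, and $c$ maps $n-1$ to $0$ fixing other states; $U_n(a,b,c)$ is its language. $L^R$ is the reversal of $L$, and $KL=\{uv: u\in K, v\in L\}$. *)

(* Defs.v *)
From mathcomp Require Import all_boot.
Set Implicit Arguments. Unset Strict Implicit. Unset Printing Implicit Defensive.

Definition language (S : Type) := seq S -> Prop.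

Definition lconcat (S : Type) (K L : language S) : language S :=
  fun w => exists u v, w = u ++ v /\ K u /\ L v.

Definition lrev (S : Type) (L : language S) : language S :=
  fun w => L (rev w).

Record dfa (S : finType) := DFA {
  dstate : finType;
  dinit : dstate;
  dfinal : pred dstate;
  dtrans : dstate -> S -> dstate }.

Definition drun (S : finType) (D : dfa S) (q : dstate D) (w : seq S) : dstate D :=
  foldl (@dtrans S D) q w.

Definition dlang (S : finType) (D : dfa S) : language S :=
  fun w => @dfinal S D (@drun S D (@dinit S D) w).

Definition state_complexity (S : finType) (L : language S) (k : nat) : Prop :=
  (exists D : dfa S, #|dstate D| = k /\ forall w, dlang D w <-> L w) /\
  (forall D : dfa S, (forall w, dlang D w <-> L w) -> k <= #|dstate D|).

Definition sigma3 := 'I_3.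
Definition la : 'I_3 := @Ordinal 3 0 erefl.
Definition lb : 'I_3 := @Ordinal 3 1 erefl.
Definition lc : 'I_3 := @Ordinal 3 2 erefl.

(* U_n(a,b,c): states {0,...,n-1} (as 'I_(n.-1).+1, which is 'I_n for n >= 1),
   initial state 0, final state n-1,
   a : i -> i+1 mod n, b : swaps 0 and 1, c : n-1 -> 0, others fixed. *)
Definition U_trans (n : nat) (i : 'I_n.-1.+1) (x : 'I_3) : 'I_n.-1.+1 :=
  if x == la then inord ((i + 1) %% n)
  else if x == lb then inord (if i == 0 :> nat then 1 else if i == 1 :> nat then 0 else i)
  else if i == ord_max then ord0 else i.

Definition U_dfa (n : nat) : dfa (ordinal 3) :=
  @DFA _ (ordinal n.-1.+1) ord0 (fun i => i == ord_max) (@U_trans n).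

Definition U_lang (n : nat) : language 'I_3 := dlang (U_dfa n).

(* Main.v *)
Require Import Defs.
From mathcomp Require Import all_boot zify.
Set Implicit Arguments. Unset Strict Implicit. Unset Printing Implicit Defensive.

(** A pair (p, S) records the state p of U_m and the set S of those states of
    U_n from which the reversal of some suffix v, with the prefix before v in
    U_m(a,b,c), leads to the final state. A letter x sends S to its preimage
    under x, and adds n-1 when U_m enters m-1; so m-1 forces n-1 into S.
    The m states (p, Q_n) are equivalent, and these are the only equivalences.

    Reachability. It suffices to reach every (0, S). The words ab, c and bcb
    return U_m to 0 and act on S by a cycle rho fixing 1 and by overwriting the
    bit n-1 with the bit 0 or the bit 1; hence (0, S) leads to
    every (0, T) having the same bit 1, as soon as some bit of S differs from it.
    Passing through m-1, where b swaps the bits 0 and 1 and leaves m-1 fixed,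
    changes that bit.

    Distinguishability. Different sets are separated by a power of a. For
    (p, S) and (q, S) with h missing from S, it is enough to drive p (and not q)
    to m-1 when the hole h sits at n-1. With the hole at 0, the letter c also
    makes a hole at n-1, which shifts the phase of h relative to p and q. *)

(** * Runs of DFAs, and state complexity through representatives *)

Lemma drun_cat (A : finType) (D : dfa A) (q : dstate D) (u v : seq A) :
  drun q (u ++ v) = drun (drun q u) v.
Proof. exact: foldl_cat. Qed.

Lemma drun_rcons (A : finType) (D : dfa A) (q : dstate D) (w : seq A) (x : A) :
  drun q (rcons w x) = dtrans (drun q w) x.
Proof. by rewrite -cats1 drun_cat. Qed.

Definition distinguishable (A : finType) (D : dfa A) (q r : dstate D) :=
  exists w, dfinal (drun q w) != dfinal (drun r w).

Lemma distinguishable_sym (A : finType) (D : dfa A) (q r : dstate D) :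
  distinguishable q r -> distinguishable r q.
Proof. by case=> w; rewrite eq_sym; exists w. Qed.

Lemma distinguishable_step (A : finType) (D : dfa A) (q r : dstate D) (x : A) :
  distinguishable (dtrans q x) (dtrans r x) -> distinguishable q r.
Proof. by case=> w; exists (x :: w). Qed.

Definition reachable (A : finType) (D : dfa A) (q : dstate D) :=
  exists w, drun (dinit D) w = q.

Lemma reachable_step (A : finType) (D : dfa A) (q : dstate D) (x : A) :
  reachable q -> reachable (dtrans q x).
Proof. by case=> w <-; exists (rcons w x); rewrite drun_rcons. Qed.

(** The states in [V] form a DFA that applies [f] after each transition. For minimality, reading an
    access word of each of them in another DFA for [L] gives an injection, as in Myhill-Nerode. *)
Lemma state_complexity_of_representatives (A : finType) (D : dfa A)
    (L : language A) (V : pred (dstate D)) (f : dstate D -> dstate D) :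
    (forall w, dlang D w <-> L w) ->
    (forall q, V q -> reachable q) ->
    (forall q r, V q -> V r -> q != r -> distinguishable q r) ->
    (forall w, V (f (drun (dinit D) w))) ->
    (forall q w, dfinal (drun (f q) w) = dfinal (drun q w)) ->
  state_complexity L #|V|.
Proof.
move=> DL reach disting Vf ff; split.
- pose q0 : {q | V q} := Sub (f (dinit D)) (Vf [::]).
  (* The default [q0] is never taken: states in [V] are reachable, so [f] sends their successors
     into [V]. *)
  pose D' := @DFA A {q | V q} q0 (fun q => dfinal (val q))
    (fun q x => insubd q0 (f (dtrans (val q) x))).
  exists D'; split; first by rewrite card_sig.
  move=> w; rewrite -DL /dlang.
  suff H (q : dstate D') : dfinal (drun q w) = dfinal (drun (val q) w).
    by rewrite H /= ff.
  elim: w q => [|x w IH] q //=.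
  rewrite /drun /= -/(drun _ _) -/(drun _ _) in IH *.
  rewrite IH insubdK ?ff //.
  have [u <-] := reach _ (valP q).
  by rewrite -topredE /= -drun_rcons Vf.
- move=> D' D'L.
  have reachb (q : {q | V q}) : exists w, drun (dinit D) w == val q.
    by have [w <-] := reach _ (valP q); exists w.
  pose g q := drun (dinit D') (xchoose (reachb q)).
  rewrite -card_sig; apply: (@leq_card _ _ g) => q r gqr.
  apply: val_inj; apply/eqP/negPn/negP => /(disting _ _ (valP q) (valP r)) [w].
  rewrite -(eqP (xchooseP (reachb q))) -(eqP (xchooseP (reachb r))).
  have E u : dfinal (drun (dinit D) u) = dfinal (drun (dinit D') u).
    by apply/idP/idP; [move/DL/D'L | move/D'L/DL].
  by rewrite -!drun_cat !E !drun_cat -/(g q) -/(g r) gqr eqxx.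
Qed.

(** By finiteness, [x] is a positive iterate of itself under [f], hence an iterate of [f x]. *)
Lemma closed_under_inverse (T : finType) (f : T -> T) (P : T -> Prop) :
  injective f -> (forall x, P x -> P (f x)) -> forall x, P (f x) -> P x.
Proof.
move=> finj Pf x Pfx.
have H k : P (iter k.+1 f x) by elim: k => //= k /Pf.
by rewrite -(iter_order finj x) -(prednK (order_gt0 f x)).
Qed.

(** * The transitions of U_n and the product automaton *)

Notation tr i x := (@U_trans _.+3 i x : 'I_(_.+3)).

Lemma val_U_la n (i : 'I_n.+3) :
  tr i la = (if i == n.+2 :> nat then 0 else i.+1) :> nat.
Proof.
rewrite /U_trans /= inordK ?ltn_pmod //.
case: eqP => [->|ni]; first by rewrite addn1 modnn.
by rewrite modn_small ?addn1 //; have := ltn_ord i; lia.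
Qed.

Lemma val_U_lb n (i : 'I_n.+3) :
  tr i lb = (if i == 0 :> nat then 1 else if i == 1 :> nat then 0 else i) :> nat.
Proof.
by rewrite /U_trans /= inordK //; have := ltn_ord i; do 2?case: ifP => //=.
Qed.

Lemma val_U_lc n (i : 'I_n.+3) :
  tr i lc = (if i == n.+2 :> nat then 0 else i) :> nat.
Proof. by rewrite /U_trans /= -val_eqE /=; case: eqP. Qed.

Lemma U_la_inj n : injective (fun i : 'I_n.+3 => tr i la).
Proof.
move=> i j /(congr1 val) /=; rewrite !val_U_la => E; apply: val_inj => /=.
by move: E; do 2?case: eqP; lia.
Qed.

Lemma U_lb_inj n : injective (fun i : 'I_n.+3 => tr i lb).
Proof.
move=> i j /(congr1 val) /=; rewrite !val_U_lb => E; apply: val_inj => /=.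
by move: E; do 4?case: eqP; lia.
Qed.

Lemma U_lbK n (i : 'I_n.+3) : tr (tr i lb) lb = i.
Proof. by apply: val_inj; rewrite /= !val_U_lb; do 4?case: eqP => //=; lia. Qed.

Lemma tr_la_inord n k : k < n.+2 -> tr (inord k : 'I_n.+3) la = inord k.+1.
Proof.
move=> lt_k; have lt_k3 : k < n.+3 by lia.
by apply: val_inj; rewrite /= val_U_la !inordK //= ltn_eqF.
Qed.

Lemma tr_lc_inord n k : k < n.+2 -> tr (inord k : 'I_n.+3) lc = inord k.
Proof.
move=> lt_k; have lt_k3 : k < n.+3 by lia.
by apply: val_inj; rewrite /= val_U_lc !inordK //= ltn_eqF.
Qed.

Lemma tr_lb_inord n k : 1 < k < n.+3 -> tr (inord k : 'I_n.+3) lb = inord k.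
Proof.
move=> /andP[lt1k lt_k].
by apply: val_inj; rewrite /= val_U_lb !inordK //= !gtn_eqF // ltnW.
Qed.

Lemma tr_la_max n : tr (ord_max : 'I_n.+3) la = ord0.
Proof. by apply: val_inj; rewrite /= val_U_la eqxx. Qed.

Lemma tr_lc_max n : tr (ord_max : 'I_n.+3) lc = ord0.
Proof. by apply: val_inj; rewrite /= val_U_lc eqxx. Qed.

Lemma tr_lb_0 n : tr (ord0 : 'I_n.+3) lb = inord 1.
Proof. by apply: val_inj; rewrite [LHS]val_U_lb [RHS]inordK. Qed.

Lemma tr_lb_1 n : tr (inord 1 : 'I_n.+3) lb = ord0.
Proof. by apply: val_inj; rewrite /= val_U_lb inordK. Qed.

Lemma inord_max n : inord n.+2 = ord_max :> 'I_n.+3.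
Proof. by apply: val_inj; rewrite /= inordK. Qed.

Lemma inord_0 n : inord 0 = ord0 :> 'I_n.+3.
Proof. by apply: val_inj; rewrite /= inordK. Qed.

Lemma tr_lb_max n : tr (ord_max : 'I_n.+3) lb = ord_max.
Proof. by apply: val_inj; rewrite /= val_U_lb. Qed.

Definition prod_dfa (m n : nat) : dfa 'I_3 :=
  @DFA _ ('I_m.+3 * {set 'I_n.+3})%type (ord0, set0) (fun q => ord0 \in q.2)
    (fun q x =>
       let p : 'I_m.+3 := @U_trans m.+3 q.1 x in
       (p, [set i : 'I_n.+3 | (@U_trans n.+3 i x \in q.2)
                              || (p == ord_max) && (i == ord_max)])).

Lemma drun_prod_dfa1 m n (q : dstate (prod_dfa m n)) w :
  (drun q w).1 = @drun _ (U_dfa m.+3) q.1 w.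
Proof. by elim/last_ind: w => // w x IH; rewrite !drun_rcons /= IH. Qed.

(** Induction on the last letter: either [v] is empty, or this letter is read first in [rev v],
    which accounts for the preimage. *)
Lemma drun_prod_dfa2 m n w (i : 'I_n.+3) :
  i \in (drun (dinit (prod_dfa m n)) w).2 <->
  exists u v, [/\ w = u ++ v, U_lang m.+3 u &
                @drun _ (U_dfa n.+3) i (rev v) = ord_max].
Proof.
elim/last_ind: w i => [|w x IH] i.
  by rewrite inE; split=> // -[[|y u]] [v] [].
rewrite !drun_rcons /= inE drun_prod_dfa1; split.
- case/orP => [/(proj1 (IH _)) [u] [v] [-> Uu Uv]|/andP[Um /eqP ->]].
    by exists u, (rcons v x); rewrite rcons_cat rev_rcons.
  by exists (rcons w x), [::]; rewrite cats0 /U_lang /dlang drun_rcons.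
- case=> u [v]; case/lastP: v => [|v y].
    rewrite cats0 => -[<-]; rewrite /U_lang /dlang drun_rcons => Uw /= ->.
    by rewrite eqxx andbT; apply/orP; right.
  rewrite -rcons_cat rev_rcons => -[/rcons_inj[Ew ->] Uu Uv].
  by apply/orP; left; apply: (proj2 (IH _)); exists u, v.
Qed.

Lemma dlang_prod_dfa m n w :
  dlang (prod_dfa m n) w <-> lconcat (U_lang m.+3) (lrev (U_lang n.+3)) w.
Proof.
rewrite /dlang /= drun_prod_dfa2; split=> -[u] [v].
  case=> -> Uu Uv; exists u, v; split=> //; split=> //.
  by rewrite /lrev /U_lang /dlang Uv /=.
by case=> -> [Uu /eqP Uv]; exists u, v.
Qed.

(** * Distinguishability *)

(** Each [a] shifts the bits down by one. A bit inserted at [ord_max] on the way arrives at 0 too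
    late to interfere. *)
Lemma prod_dfa_read_la m n (q : dstate (prod_dfa m n)) (i : 'I_n.+3) :
  dfinal (drun q (nseq i la)) = (i \in q.2).
Proof.
case: i => k; elim: k q => [|k IH] q lt_k /=.
  by rewrite (_ : Ordinal lt_k = ord0) //; apply: val_inj.
have lt_k' : k < n.+3 by lia.
rewrite /drun /= -/(drun _ _); have /= -> := IH (dtrans q la) lt_k'.
have ne : (Ordinal lt_k' == ord_max) = false by rewrite -val_eqE /= ltn_eqF.
rewrite inE ne andbF orbF (_ : tr _ la = Ordinal lt_k) //.
by apply: val_inj; rewrite /= val_U_la /= ltn_eqF.
Qed.

Lemma distinguishable_sets m n (p q : 'I_m.+3) (S T : {set 'I_n.+3}) :
  S != T -> @distinguishable _ (prod_dfa m n) (p, S) (q, T).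
Proof.
move=> neqST; have [i] : exists i, (i \in S) != (i \in T).
  apply/existsP; apply: contraNT neqST; rewrite negb_exists => /forallP H.
  by apply/eqP/setP => i; apply/eqP; have := H i; rewrite negbK.
by exists (nseq i la); rewrite !prod_dfa_read_la.
Qed.

Definition valid m n (q : dstate (prod_dfa m n)) :=
  (q.1 == ord_max) ==> (ord_max \in q.2).

Lemma valid_step m n (q : dstate (prod_dfa m n)) x : valid (dtrans q x).
Proof. by apply/implyP => /= ->; rewrite inE eqxx orbT. Qed.

(* Vacuous when h = n-1 and p or q is m-1, since validity then puts n-1 in S. *)
Definition hole_splits m n (p q : 'I_m.+3) (h : 'I_n.+3) :=
  p != q -> forall S : {set 'I_n.+3}, h \notin S ->
  @valid m n (p, S) -> @valid m n (q, S) ->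
  @distinguishable _ (prod_dfa m n) (p, S) (q, S).

(** * Two states of U_m over a common set with a hole *)

Section Holes.
Variables m n : nat.
Implicit Types (p q : 'I_m.+3) (h : 'I_n.+3).

Lemma hole_splits_sym p q h : hole_splits p q h -> hole_splits q p h.
Proof.
by move=> H neq S hS vq vp; apply/distinguishable_sym/H => //; rewrite eq_sym.
Qed.

Lemma hole_splits_max q : hole_splits ord_max q (ord_max : 'I_n.+3).
Proof. by move=> _ S hS; rewrite /valid /= eqxx (negPf hS). Qed.

(** If the successor sets differ, a power of [a] separates them. If they agree, the hole is still
    open at [h]: filling it in both would need two distinct states at [ord_max]. *)
Lemma hole_splits_step x p q h :
  (p != q -> tr p x != tr q x) ->
  hole_splits (tr p x) (tr q x) h -> hole_splits p q (tr h x).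
Proof.
move=> neqx H neq S hS vp vq.
apply: (@distinguishable_step _ (prod_dfa m n) _ _ x).
set P := dtrans _ _; set Q := dtrans _ _.
have [eqS|] := eqVneq P.2 Q.2; last first.
  rewrite [P]surjective_pairing [Q]surjective_pairing.
  exact: distinguishable_sets.
have vP : valid P by apply: valid_step.
have vQ : valid Q by apply: valid_step.
rewrite [P]surjective_pairing [Q]surjective_pairing -eqS in vP vQ *.
apply: H => //; first exact: neqx.
apply/negP => hP; have := hP; have := hP; rewrite {1}eqS !inE (negPf hS) /=.
case/andP => /eqP E1 _ /andP[/eqP E2 _].
by have := neqx neq; rewrite E1 E2 eqxx.
Qed.

(* The converse holds because a permutes the finitely many triples (p, q, h). *)
Lemma hole_splits_la p q h :
  hole_splits (tr p la) (tr q la) h <-> hole_splits p q (tr h la).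
Proof.
split; first by apply: hole_splits_step; rewrite (inj_eq (@U_la_inj m)).
pose f (t : 'I_m.+3 * 'I_m.+3 * 'I_n.+3) :=
  (tr t.1.1 la, tr t.1.2 la, invF (@U_la_inj n) t.2).
pose P (t : 'I_m.+3 * 'I_m.+3 * 'I_n.+3) := hole_splits t.1.1 t.1.2 t.2.
have fi : injective f.
  move=> [[p1 q1] h1] [[p2 q2] h2] [/U_la_inj -> /U_la_inj ->].
  by move/(can_inj (f_invF (@U_la_inj n))) => ->.
have Pf t : P (f t) -> P t.
  rewrite /P /f /= => H.
  rewrite -[t.2](f_invF (@U_la_inj n)).
  by apply: hole_splits_step; first by rewrite (inj_eq (@U_la_inj m)).
move=> H; have := closed_under_inverse (P := P) (f := finv f) (finv_inj fi).
move=> /(_ _ (tr p la, tr q la, h)); apply.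
  by move=> t Pt; apply: Pf; rewrite f_finv.
have -> : (tr p la, tr q la, h) = f (p, q, tr h la) by rewrite /f /= invF_f.
by rewrite finv_f.
Qed.

Lemma hole_splits_lb p q h :
  hole_splits (tr p lb) (tr q lb) h -> hole_splits p q (tr h lb).
Proof. by apply: hole_splits_step; rewrite (inj_eq (@U_lb_inj m)). Qed.

Notation E p q := (hole_splits (inord p : 'I_m.+3) (inord q) (ord0 : 'I_n.+3)).

(** Reading [a] takes both the hole and the first state to their [ord_max], so only the first set
    has its hole filled. *)
Lemma hole_splits_base q : hole_splits (inord m.+1) q (ord0 : 'I_n.+3).
Proof.
rewrite -(tr_la_max n); apply/hole_splits_la.
by rewrite tr_la_inord // inord_max; apply: hole_splits_max.
Qed.

(* The word c a^-1: [c] copies the hole at 0 to n-1 and fixes both shifted states,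
   and undoing [a] brings the hole back to 0. *)
Lemma hole_splits_rotate p q :
  tr p la != ord_max -> tr q la != ord_max ->
  hole_splits p q (ord0 : 'I_n.+3) ->
  hole_splits (tr p la) (tr q la) (ord0 : 'I_n.+3).
Proof.
have fix_c r : r != ord_max -> tr r lc = r.
  move=> nr; apply: val_inj; rewrite /= val_U_lc.
  by move: nr; rewrite -val_eqE /=; case: eqP.
move=> np nq; rewrite -{1}(tr_la_max n) -hole_splits_la => H.
by rewrite -(tr_lc_max n); apply: hole_splits_step; rewrite !fix_c.
Qed.

Lemma inord_neq_max k : k < m.+2 -> (inord k : 'I_m.+3) != ord_max.
Proof. by move=> lt_k; rewrite -val_eqE /= inordK ?ltn_eqF // ltnW. Qed.

(** This pair starts the rotations below. The phase is changed by [b], which moves the hole from 1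
    to 0; it fixes both states m+1 and m+2 only if m > 0, so m = 0 takes another word. *)
Lemma hole_splits_max0 : E m.+2 0.
Proof.
rewrite inord_max inord_0; case: (posnP m) => [m0|m_gt0].
- rewrite -(tr_lb_1 n); apply: hole_splits_lb.
  have max2 : (ord_max : 'I_m.+3) = inord 2.
    by rewrite -inord_max m0.
  (* b c b leads from ({2, 0}, hole 0) to ({1, 0}, hole 0) when m = 0. *)
  rewrite {1}max2 tr_lb_inord -?max2; last by rewrite m0.
  rewrite tr_lb_0.
  have -> : (inord 1 : 'I_n.+3) = tr (inord 1) lc by rewrite tr_lc_inord.
  apply: hole_splits_step; rewrite tr_lc_max tr_lc_inord //.
    by move=> _; rewrite -val_eqE /= inordK.
  rewrite -(tr_lb_0 n); apply: hole_splits_lb.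
  rewrite tr_lb_0 (_ : inord 1 = inord m.+1 :> 'I_m.+3); last by rewrite m0.
  exact: hole_splits_base.
- (* The swap b sees only the hole once the pair is rotated to {m+1, m+2}. *)
  rewrite -(tr_la_max m) -[X in hole_splits X _ _]inord_max -tr_la_inord //.
  apply/hole_splits_la; rewrite -{1}(inord_0 n) tr_la_inord // -(tr_lb_0 n).
  apply: hole_splits_lb; rewrite tr_lb_inord ?ltnS ?m_gt0 //=.
  exact: hole_splits_base.
Qed.

Lemma hole_splits_exit (q : nat) : 0 < q < m.+2 -> E 0 q -> E m.+2 q.
Proof.
move=> /andP[q_gt0 lt_q]; rewrite inord_0 inord_max => H.
have -> : ord0 = tr (ord0 : 'I_n.+3) lc by rewrite -inord_0 tr_lc_inord.
apply: hole_splits_step; rewrite tr_lc_max tr_lc_inord // => _.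
by rewrite -val_eqE /= inordK ?ltn_eqF // ltnW.
Qed.

(** From {0, q}, [hole_splits_exit] gives {m+2, q} and a rotation then gives {0, q+1}. The start {0,
    1} is {m+2, 0} rotated. *)
Lemma hole_splits_0q (q : nat) : 0 < q < m.+2 -> E 0 q.
Proof.
case: q => // q; elim: q => [|q IH] lt_q.
- have := @hole_splits_rotate ord_max (inord 0).
  rewrite tr_la_max tr_la_inord // -(inord_0 m) !inord_neq_max //.
  by apply=> //; rewrite -inord_max; apply: hole_splits_max0.
- have := @hole_splits_rotate ord_max (inord q.+1).
  rewrite tr_la_max tr_la_inord; last by lia.
  rewrite -(inord_0 m) !inord_neq_max //.
  apply=> //; rewrite -inord_max; apply: hole_splits_exit; first by lia.
  by apply: IH; lia.
Qed.

Lemma hole_splits_lt (p q : nat) : p < q < m.+3 -> E p q.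
Proof.
have [->|neq_q] := eqVneq q m.+2.
  case: p => [|p] lt_p; apply: hole_splits_sym; first exact: hole_splits_max0.
  by apply: hole_splits_exit; [lia | apply: hole_splits_0q; lia].
(* Below [ord_max], the pair {p, q} is {0, q-p} rotated [p] times. *)
move=> lt_pq; have {neq_q lt_pq} : p < q < m.+2 by lia.
elim: p q => [|p IH] [|q] // lt_pq; first by apply: hole_splits_0q; lia.
have := @hole_splits_rotate (inord p) (inord q).
rewrite !tr_la_inord ?inord_neq_max; try lia.
by apply=> //; apply: IH; lia.
Qed.

Lemma hole_splitsT p q h : hole_splits p q h.
Proof.
rewrite -(inord_val h); have := ltn_ord h; move: (val h) => {h} k.
elim: k p q => [|k IH] p q lt_k; last first.
  by rewrite -tr_la_inord //; apply/hole_splits_la/IH; lia.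
rewrite inord_0 -(inord_val p) -(inord_val q).
case: (ltngtP p q) => [lt_pq|lt_qp|->]; last by rewrite /hole_splits eqxx.
  by apply: hole_splits_lt; rewrite lt_pq ltn_ord.
by apply/hole_splits_sym/hole_splits_lt; rewrite lt_qp ltn_ord.
Qed.

End Holes.

Lemma prod_dfa_distinguishable m n (q r : dstate (prod_dfa m n)) :
  valid q -> valid r -> q.2 != setT -> q != r -> distinguishable q r.
Proof.
case: q r => [p S] [q T] /= vp vq nS neq.
have [eqST|] := eqVneq S T; last exact: distinguishable_sets.
rewrite -eqST in vq neq *.
have [i hS] : exists i, i \notin S.
  apply/existsP; rewrite -negb_forall; apply: contra nS => /forallP H.
  by apply/eqP/setP => i; rewrite H inE.
apply: (@hole_splitsT _ _ p q i) => //.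
by apply: contra neq => /eqP ->.
Qed.

(** * Reachability *)

Lemma prod_step_not_max m n (p p' : 'I_m.+3) (S : {set 'I_n.+3}) x :
  tr p x = p' -> p' != ord_max ->
  dtrans (d := prod_dfa m n) (p, S) x = (p', (fun i => tr i x) @^-1: S).
Proof.
by move=> <- /negPf np /=; congr pair; apply/setP => i; rewrite !inE np orbF.
Qed.

(** Preimages compose in reverse, so the word ab acts with [b] innermost. The cycle is 0, 2, 3, ...,
    [ord_max]. *)
Definition rho n (i : 'I_n.+3) : 'I_n.+3 := tr (tr i lb) la.

(** * Sets reachable over the state 0 of U_m *)

Section Home.
Variables m n : nat.
Implicit Types (S : {set 'I_n.+3}) (g : 'I_n.+3 -> 'I_n.+3).
Notation one := (inord 1 : 'I_n.+3).

Definition home S := @reachable _ (prod_dfa m n) (ord0, S).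
Definition stable g := forall S, home S -> home (g @^-1: S).

Lemma home_step (q : dstate (prod_dfa m n)) (p' : 'I_m.+3) x :
  reachable q -> tr q.1 x = p' -> p' != ord_max ->
  @reachable _ (prod_dfa m n) (p', (fun i => tr i x) @^-1: q.2).
Proof.
case: q => p S Hq E np; rewrite -(prod_step_not_max S E np).
exact: reachable_step.
Qed.

Lemma stable_eq g1 g2 : g1 =1 g2 -> stable g1 -> stable g2.
Proof.
by move=> E H S /H; congr home; apply/setP => i; rewrite !inE E.
Qed.

Lemma stable_comp g1 g2 : stable g1 -> stable g2 -> stable (g1 \o g2).
Proof.
by move=> H1 H2 S /H1/H2; congr home; apply/setP => i; rewrite !inE.
Qed.

Lemma stable_lc : stable (fun i => tr i lc).
Proof. by move=> S H; apply: (home_step (x := lc) H). Qed.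

Lemma stable_rho : stable (@rho n).
Proof.
move=> S H.
have H1 : @reachable _ (prod_dfa m n) (inord 1, (fun i => tr i la) @^-1: S).
  apply: (home_step (x := la) H); last by rewrite inord_neq_max.
  by rewrite /= -[in LHS]inord_0 tr_la_inord.
have := @home_step _ ord0 lb H1; rewrite tr_lb_1 => /(_ erefl isT).
by congr home; apply/setP => i; rewrite !inE.
Qed.

Lemma stable_conj_lc : stable (fun i => tr (tr (tr i lb) lc) lb).
Proof.
move=> S H.
have H1 : @reachable _ (prod_dfa m n) (inord 1, (fun i => tr i lb) @^-1: S).
  by apply: (home_step (x := lb) H); rewrite ?inord_neq_max ?tr_lb_0.
have := @home_step _ (inord 1) lc H1.
rewrite tr_lc_inord ?inord_neq_max // => /(_ erefl isT) H2.
have := @home_step _ ord0 lb H2; rewrite tr_lb_1 => /(_ erefl isT).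
by congr home; apply/setP => i; rewrite !inE.
Qed.

Lemma rho_inj : injective (@rho n).
Proof. by move=> i j /U_la_inj /U_lb_inj. Qed.

Lemma rho_one : rho one = one.
Proof. by rewrite /rho tr_lb_1 -inord_0 tr_la_inord. Qed.

Lemma rho_max : rho (ord_max : 'I_n.+3) = ord0.
Proof. by rewrite /rho tr_lb_max tr_la_max. Qed.

Lemma rho_inord k : 1 < k < n.+2 -> rho (inord k : 'I_n.+3) = inord k.+1.
Proof. by move=> lt_k; rewrite /rho tr_lb_inord ?tr_la_inord //; lia. Qed.

Lemma rho_ind (P : 'I_n.+3 -> Prop) :
  P ord0 -> (forall y, P y -> P (rho y)) -> forall y, y != one -> P y.
Proof.
move=> P0 Pr y; rewrite -val_eqE /= inordK // -[y]inord_val => ny1.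
have := ltn_ord y; rewrite inordK // in ny1; move: (val y) ny1 => k.
elim: k => [|[|[|k]] IH] // _ lt_k; first by rewrite inord_0.
- suff <- : rho ord0 = inord 2 :> 'I_n.+3 by apply: Pr.
  by rewrite /rho tr_lb_0 tr_la_inord.
- by rewrite -rho_inord; [apply: Pr; apply: IH; lia | lia].
Qed.

(** Here [g'] is [g] conjugated by [rho]. Undoing [rho] is allowed because its preimage map permutes
    the finitely many sets. *)
Lemma stable_conj g g' :
  (forall i, g' (rho i) = rho (g i)) -> stable g -> stable g'.
Proof.
move=> E H S HS.
apply: (closed_under_inverse (f := fun S => @rho n @^-1: S)).
- move=> A B /setP E'; apply/setP => i.
  by have := E' (invF rho_inj i); rewrite !inE f_invF.
- exact: stable_rho.
- have := H _ (stable_rho HS).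
  by congr home; apply/setP => i; rewrite !inE E.
Qed.

(** Taking the preimage of a set under this map overwrites its bit [y] with its bit [t]. *)
Definition redirect (y t i : 'I_n.+3) := if i == y then t else i.

(** At [ord_max] this is the action of bcb; conjugation by [rho], which fixes 1, carries it along
    the cycle. *)
Lemma stable_redirect_one y : y != one -> stable (redirect y one).
Proof.
have step z : stable (redirect z one) -> stable (redirect (rho z) one).
  apply: stable_conj => i.
  by rewrite /redirect (inj_eq rho_inj); case: eqP; rewrite ?rho_one.
move: y; apply: rho_ind => //; rewrite -rho_max; apply: step.
apply: stable_eq stable_conj_lc => i; rewrite /redirect.
case: eqP => [->|/eqP ni].
  by rewrite tr_lb_max tr_lc_max tr_lb_0.
suff -> : tr (tr i lb) lc = tr i lb by rewrite U_lbK.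
apply: val_inj; rewrite /= val_U_lc ifN //.
apply: contra ni; rewrite val_U_lb -val_eqE /=.
by case: ifP => // _; case: ifP.
Qed.

(** At [ord_max] this is the action of [c], again carried along the cycle. *)
Lemma stable_redirect_rho y : y != one -> stable (redirect y (rho y)).
Proof.
have step z :
    stable (redirect z (rho z)) -> stable (redirect (rho z) (rho (rho z))).
  apply: stable_conj => i.
  by rewrite /redirect (inj_eq rho_inj); case: eqP.
move: y; apply: rho_ind => //; rewrite -[ord0]rho_max; apply: step.
apply: stable_eq stable_lc => i; rewrite /redirect rho_max.
case: eqP => [->|/eqP ni]; first by rewrite tr_lc_max.
by apply: val_inj; rewrite /= val_U_lc ifN.
Qed.

Lemma stable_collapse y :
  y != one -> stable (fun i => if i == one then one else y).
Proof.
move: y; apply: rho_ind => [|y H]; last first.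
  apply: stable_eq (stable_comp stable_rho H) => i /=.
  by case: eqP; rewrite ?rho_one.
(* States are sent to 0 from the top down: each goes to its successor under [rho], which already
   goes to 0. At k = n+1 only 0 and 1 stay in place. *)
have H k : k <= n.+1 ->
    stable (fun i : 'I_n.+3 => if n.+3 - k <= i then ord0 else i).
  elim: k => [|k IH] lt_k.
    move=> S; congr home; apply/setP => i; rewrite inE ifN //.
    by have := ltn_ord i; lia.
  set y : 'I_n.+3 := inord (n.+3 - k.+1).
  have vy : y = n.+3 - k.+1 :> nat by rewrite inordK //; lia.
  have ny : y != one by rewrite -val_eqE /= vy inordK //; lia.
  apply: stable_eq (stable_comp (IH _) (stable_redirect_rho ny)); last by lia.
  move=> i; rewrite /= /redirect; case: eqP => [->|/eqP].
    rewrite [in RHS]vy leqnn; case: (posnP k) => [k0|k_gt0].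
      have -> : y = ord_max by apply: val_inj => /=; lia.
      by rewrite rho_max; case: ifP.
    rewrite rho_inord ?inordK ?ifT //; lia.
  rewrite -val_eqE /= vy => ni.
  by case: ifP; case: ifP => //; lia.
apply: stable_eq (H n.+1 _) => // i.
rewrite -!(inj_eq val_inj) /= inordK //.
case: (ltngtP i 1) => h; case: ifP => //; try lia.
all: by move=> _; apply: val_inj; rewrite /= ?inordK //; lia.
Qed.

Lemma stable_split y (s : seq 'I_n.+3) : y != one ->
  stable (fun i => if (i == one) || (i \in s) then one else y).
Proof.
move=> ny; elim: s => [|z s IH].
  by apply: stable_eq (stable_collapse ny) => i; rewrite orbF.
have [->|nz] := eqVneq z one.
  by apply: stable_eq IH => i; rewrite inE orbA orbb.
apply: stable_eq (stable_comp IH (stable_redirect_one nz)) => i.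
rewrite /= /redirect inE; case: (i =P z) => [->|_] //=.
by rewrite eqxx orbT.
Qed.

(** The bits 1 and [y] of [S0] are opposite, so copying one or the other into each position other
    than 1 yields [S]. *)
Lemma home_class S0 S y :
  home S0 -> (y \in S0) = (one \notin S0) ->
  (one \in S) = (one \in S0) -> home S.
Proof.
move=> H0 Hy H1; have ny : y != one.
  by apply: contra_eq_neq Hy => ->; case: (_ \in _).
have := stable_split (enum [set i | (i \in S) == (one \in S0)]) ny H0.
congr home; apply/setP => i; rewrite inE mem_enum inE.
case: (i =P one) => [->|_] /=; first by rewrite H1.
by case: eqP => [->|] //; rewrite Hy; do 2!case: (_ \in _).
Qed.

(** * Passing through the last state of U_m to change the bit 1 *)

Lemma reachable_iter_la S k : home S -> k <= m.+1 ->
  @reachable _ (prod_dfa m n) (inord k, iter k (fun i => tr i la) @^-1: S).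
Proof.
move=> H; elim: k => [|k IH] lt_k.
  by rewrite inord_0; move: H; congr home; apply/setP => i; rewrite inE.
have := home_step (x := la) (p' := inord k.+1) (IH (ltnW lt_k)).
rewrite tr_la_inord ?inord_neq_max => [/(_ erefl isT)||]; try lia.
by congr reachable; congr pair; apply/setP => i; rewrite !inE -iterSr.
Qed.

Lemma reachable_max S : home S ->
  @reachable _ (prod_dfa m n)
    (ord_max, ord_max |: iter m.+2 (fun i => tr i la) @^-1: S).
Proof.
move=> H; have := reachable_step la (reachable_iter_la H (leqnn m.+1)).
congr reachable; rewrite /= tr_la_inord // inord_max; congr pair.
by apply/setP => i; rewrite !inE eqxx orbC -iterSr.
Qed.

Lemma home_exit (T : {set 'I_n.+3}) x :
  @reachable _ (prod_dfa m n) (ord_max, T) -> tr (ord_max : 'I_m.+3) x = ord0 ->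
  home ((fun i => tr i x) @^-1: T).
Proof. by move=> H E; apply: (home_step (x := x) H). Qed.

(** The two bits compared in [S] are those that m+2 letters [a] carry to 0 and 1. If the bit 1 is
    then wrong, [b] swaps them; [c] returns to 0 and keeps both. *)
Lemma home_both_classes S z :
  home S ->
  (iter m.+2 (fun i => tr i la) ord0 \in S) !=
  (iter m.+2 (fun i => tr i la) one \in S) ->
  exists S', [/\ home S', (one \in S') = z & (ord0 \in S') = ~~ z].
Proof.
move=> /reachable_max; set T := _ |: _; move=> HT neq.
have neq1 : (one == ord_max) = false by rewrite -val_eqE /= inordK.
have {neq} neqT : (ord0 \in T) != (one \in T).
  by rewrite !inE neq1 in neq *.
have fix0 : tr (ord0 : 'I_n.+3) lc = ord0 by rewrite -inord_0 tr_lc_inord.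
have fix1 : tr one lc = one by rewrite tr_lc_inord.
clearbody T; have [E1|E1] := eqVneq (one \in T) z.
  exists ((fun i => tr i lc) @^-1: T); split.
  - by apply: home_exit HT (tr_lc_max m).
  - by rewrite inE fix1.
  - rewrite inE fix0; move: neqT; rewrite E1.
    by do 2?case: (_ \in _); case: z {E1}.
have := reachable_step lb HT.
rewrite /= tr_lb_max => /home_exit /(_ (tr_lc_max m)).
set S' := _ @^-1: _ => HS'; exists S'; split => //.
- rewrite !inE fix1 tr_lb_1 neq1 andbF orbF.
  by move: neqT E1; case: z; do 2?case: (_ \in _).
- rewrite !inE fix0 tr_lb_0 andbF orbF.
  by move: E1; case: z; case: (_ \in _).
Qed.

Lemma homeT S : home S.
Proof.
pose a i := tr i la : 'I_n.+3.
pose S0 := a @^-1: [set ord_max].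
have H0 : home S0.
  have : home set0 by exists [::].
  move=> /reachable_max; set T := _ |: _ => HT.
  have := home_exit HT (tr_la_max m); congr home.
  by apply/setP => i; rewrite !inE orbF.
have [y Hy] : exists y, (y \in S0) = (one \notin S0).
  (* [S0] is the singleton of n+1, and n+1 is 1 exactly when n = 0; hence the two witnesses. *)
  case E : (one \in S0); last first.
    by exists (inord n.+1); rewrite !inE /a tr_la_inord // inord_max eqxx.
  by exists ord0; rewrite !inE /a -inord_0 tr_la_inord // -val_eqE /= inordK.
have class S1 : (one \in S1) = (one \in S0) -> home S1.
  by apply: home_class H0 Hy.
have iter_inj k : injective (iter k a).
  by elim: k => // k IH i j /U_la_inj /IH.
set u := iter m.+2 a ord0; set v := iter m.+2 a one.
have neuv : u != v by rewrite (inj_eq (@iter_inj _)) -val_eqE /= inordK.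
(* One of [u], [v] is not 1. In [S1] that bit alone differs from all the others, so the bits [u] and
   [v] are opposite while the bit 1 is as in [S0]. *)
have [x nx xuv] : exists2 x, x != one & (x == u) != (x == v).
  have [E|nu] := eqVneq u one.
    by exists v; [rewrite -E eq_sym | rewrite eqxx (eq_sym v) (negPf neuv)].
  by exists u; rewrite // eqxx (negPf neuv).
pose S1 := [set i | (i != x) == (one \in S0)].
have H1 : home S1 by apply: class; rewrite inE (eq_sym one) nx; case: (_ \in S0).
have [|S' [HS' E1 E0]] := @home_both_classes S1 (one \in S) H1.
  rewrite -/a -/u -/v !inE (eq_sym u) (eq_sym v); move: xuv.
  by case: (x == u); case: (x == v); case: (_ == ord_max).
by apply: (home_class (y := ord0) HS'); rewrite E1 ?E0.
Qed.

End Home.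

(** Since [a] permutes the states of U_n, the set to start from over 0 is found by taking images. On
    entering [ord_max], the inserted bit is already in [S] by validity. *)
Lemma prod_dfa_reachable m n (q : dstate (prod_dfa m n)) :
  valid q -> reachable q.
Proof.
case: q => p S; rewrite /valid /= => vq.
have imE T (i : 'I_n.+3) :
    (tr i la \in (fun i : 'I_n.+3 => tr i la) @: T) = (i \in T).
  by apply/imsetP/idP => [[j jT /U_la_inj ->]|iT] //; exists i.
have low k T : k <= m.+1 -> @reachable _ (prod_dfa m n) (inord k, T).
  elim: k T => [|k IH] T lt_k; first by rewrite inord_0; apply: homeT.
  have := home_step (x := la) (p' := inord k.+1)
    (IH ((fun i : 'I_n.+3 => tr i la) @: T) (ltnW lt_k)).
  rewrite tr_la_inord ?inord_neq_max => [/(_ erefl isT)||]; try lia.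
  by congr reachable; congr pair; apply/setP => i; rewrite inE imE.
have [pm|np] := eqVneq p ord_max; last first.
  rewrite -(inord_val p); apply: low.
  by have := ltn_ord p; move: np; rewrite -val_eqE /=; lia.
rewrite pm eqxx /= in vq *.
have := reachable_step la
  (low m.+1 ((fun i : 'I_n.+3 => tr i la) @: S) (leqnn _)).
congr reachable; rewrite /= tr_la_inord // inord_max eqxx; congr pair.
apply/setP => i; rewrite inE imE.
by case: (i =P ord_max) => [->|_]; rewrite ?vq ?orbF.
Qed.

(** * State count *)

Lemma card_sets_containing (T : finType) (x : T) :
  #|[set S : {set T} | x \in S]| = 2 ^ #|T|.-1.
Proof.
have -> : [set S : {set T} | x \in S] = @setC T @: powerset [set~ x].
  apply/setP => S; rewrite -{2}[S]setCK mem_imset; last exact: setC_inj.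
  by rewrite inE powersetE setCS sub1set.
by rewrite (card_imset _ (@setC_inj T)) card_powerset cardsC1.
Qed.

(** The class of the full set is represented at [ord_max]; each other state keeps all sets but the
    full one, and [ord_max] keeps all sets containing the last state of U_n. *)
Definition canonical m n (q : dstate (prod_dfa m n)) :=
  valid q && ((q.2 == setT) ==> (q.1 == ord_max)).

Lemma card_canonical m n :
  #|@canonical m n| = m.+2 * 2 ^ n.+3 + 2 ^ n.+2 - m.+2.
Proof.
have -> : #|@canonical m n| =
   #|setX [set~ (ord_max : 'I_m.+3)] [set~ ([set: 'I_n.+3])]| +
   #|setX [set (ord_max : 'I_m.+3)] [set S : {set 'I_n.+3} | ord_max \in S]|.
  rewrite -cardsUI (_ : _ :&: _ = set0) ?cards0 ?addn0.
    rewrite -[LHS]cardsE; apply: eq_card => -[p S].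
    rewrite !inE unfold_in /canonical /valid /=.
    by case: (p == _); case: eqP => [->|] //; rewrite ?inE ?orbF ?andbT.
  by apply/setP => -[p S]; rewrite !inE; case: (p == _) => //=; rewrite andbF.
rewrite !cardsX cards1 mul1n card_sets_containing !cardsC1 card_ord.
rewrite -[#|{set _}|]cardsT -powersetT card_powerset cardsT card_ord /=.
(* Positivity of the power keeps the truncated subtraction of 1 exact. *)
have := expn_gt0 2 n.+3; move: (2 ^ n.+3) (2 ^ n.+2) => x y; nia.
Qed.

Definition canon m n (q : dstate (prod_dfa m n)) : dstate (prod_dfa m n) :=
  if q.2 == setT then (ord_max, setT) else q.

Lemma dfinal_drun_setT m n (q : dstate (prod_dfa m n)) w :
  q.2 = setT -> dfinal (drun q w).
Proof.
elim: w q => [|x w IH] q qT; first by rewrite /= qT inE.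
by apply: IH; apply/setP => i; rewrite !inE qT inE.
Qed.

Lemma dfinal_drun_canon m n (q : dstate (prod_dfa m n)) w :
  dfinal (drun (canon q) w) = dfinal (drun q w).
Proof. by rewrite /canon; case: eqP => // qT; rewrite !dfinal_drun_setT. Qed.

Theorem theorem4 (m n : nat) (hm : 3 <= m) (hn : 3 <= n) :
  state_complexity (lconcat (U_lang m) (lrev (U_lang n)))
    ((m - 1) * 2 ^ n + 2 ^ (n - 1) - (m - 1)).
Proof.
case: m hm => [|[|[|m]]] // _; case: n hn => [|[|[|n]]] // _.
rewrite !subn1 /= -card_canonical.
apply: (@state_complexity_of_representatives _ (prod_dfa m n) _ _ (@canon m n)).
- exact: dlang_prod_dfa.
- by move=> q /andP[/prod_dfa_reachable].
- move=> q r /andP[vq cq] /andP[vr cr] neq.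
  have [qT|nqT] := eqVneq q.2 setT; last exact: prod_dfa_distinguishable.
  have [rT|nrT] := eqVneq r.2 setT; last first.
    by apply/distinguishable_sym/prod_dfa_distinguishable => //; rewrite eq_sym.
  move: cq cr neq; rewrite qT rT eqxx /= => /eqP q1 /eqP r1 /negP[].
  by rewrite [q]surjective_pairing [r]surjective_pairing q1 r1 qT rT.
- move=> w; rewrite /canon; case: eqP => [_|/eqP nT].
    by rewrite /canonical /valid /= inE !eqxx.
  (* The initial state is valid because 0 is not [ord_max]; after a nonempty word the state is a
     successor. *)
  rewrite /canonical (negPf nT) andbT; case/lastP: w {nT} => [|w x] //.
  by rewrite drun_rcons valid_step.
- exact: dfinal_drun_canon.
Qed.
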